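(* Let $m\ge1$, $0<q<1$. For every $r,s\ge0$ and $0\le n\le m$, $$\mathcal H_{q;r,s}^n=\mathcal M_{q;r,s}^n\oplus\widehat{\mathcal Z}\mathcal M_{q;r-1,s}^{n+1}\oplus\widehat{\mathcal Z}^\dagger\mathcal M_{q;r,s-1}^{n-1}\oplus\mathbf 1_{1\le n\le m-1}\,\widehat X_{r-1,s-1,n}\mathcal M_{q;r-1,s-1}^n,$$ where a summand with a negative polynomial degree or an invalid spin degree is zero. Moreover, denoting by $\mathscr R_{q;r,s}^n$ the four-term right-hand side, $$\mathscr P_{r,s}^n=\bigoplus_{j=0}^{\min(r,s)}\widehat\rho^{\,j}\,\mathscr R_{q;r-j,s-j}^n.$$
   Context: $[r]_q=\frac{1-q^r}{1-q}$, $[\alpha]_q!=\prod_i\prod_{k=1}^{\alpha_i}[k]_q$, $\alpha!=\prod_i\alpha_i!$. $\mathscr P_m=\mathbb C[z_1,\dots,z_m,w_1,\dots,w_m]\otimes\bigwedge\mathbb C^m$ with basis $z^\alpha w^\beta e_S$; $\mathscr P_{r,s}^n$ is the span of those with $|\alpha|=r,|\beta|=s,|S|=n$. $D_{q,x}f=\frac{f(\dots,qx,\dots)-f(\dots,x,\dots)}{(q-1)x}$; $\varepsilon_i$ is exterior multiplication by the $i$-th basis vector, $\iota_i=\varepsilon_i^*$ contraction. $\mathcal D_q=\sum_i\varepsilon_iD_{q,z_i}$, $\mathcal D_q^\dagger=\sum_i\iota_iD_{q,w_i}$, $\Delta_q=\sum_iD_{q,z_i}D_{q,w_i}$. $\mathcal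 H_{q;r,s}^n=\ker\Delta_q\cap\mathscr P_{r,s}^n$ and $\mathcal M_{q;r,s}^n=\ker\mathcal D_q\cap\ker\mathcal D_q^\dagger\cap\mathscr P_{r,s}^n$. $G_q(z^\alpha w^\beta e_S)=\frac{\alpha!\,\beta!}{[\alpha]_q!\,[\beta]_q!}z^\alpha w^\beta e_S$; $\widehat z_i=G_qz_iG_q^{-1}$, $\widehat w_i=G_qw_iG_q^{-1}$; $\widehat{\mathcal Z}=\sum_i\iota_i\widehat z_i$, $\widehat{\mathcal Z}^\dagger=\sum_i\varepsilon_i\widehat w_i$, $\widehat\rho=\sum_i\widehat z_i\widehat w_i$. For $a,b\ge0$, $0\le n\le m$: $\widehat X_{a,b,n}=(a+n)\widehat{\mathcal Z}\widehat{\mathcal Z}^\dagger-(b+m-n)\widehat{\mathcal Z}^\dagger\widehat{\mathcal Z}$. *)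

(* Defs.v *)
From HB Require Import structures.
From mathcomp Require Import all_boot all_order all_algebra.
From mathcomp Require Import mpoly.
From mathcomp Require Import classical_sets.

Set Implicit Arguments.
Unset Strict Implicit.
Unset Printing Implicit Defensive.

Import Order.TTheory GRing.Theory Num.Theory.

Local Open Scope classical_set_scope.
Local Open Scope ring_scope.

(* Spans and internal direct sums; mathcomp's vspaces do not apply because the
   ambient space is infinite-dimensional. *)
Section Subspaces.
Context {K : fieldType} {V : lmodType K}.

Definition lspan (B : set V) : set V :=
  [set x | exists (k : nat) (c : 'I_k -> K) (v : 'I_k -> V),
     (forall i, B (v i)) /\ x = \sum_(i < k) c i *: v i].

Definition sumset (k : nat) (W : 'I_k -> set V) : set V :=
  [set x | exists y : 'I_k -> V, (forall i, W i (y i)) /\ x = \sum_(i < k) y i].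

Definition independent (k : nat) (W : 'I_k -> set V) : Prop :=
  forall y : 'I_k -> V, (forall i, W i (y i)) ->
    \sum_(i < k) y i = 0 -> forall i, y i = 0.

Definition is_direct_sum (U : set V) (k : nat) (W : 'I_k -> set V) : Prop :=
  U = sumset W /\ independent W.

End Subspaces.

Section QCalculus.
Context {K : fieldType}.
Implicit Types q : K.

Definition qnum q (r : nat) : K := (1 - q ^+ r) / (1 - q).

Definition qfactm q (m : nat) (a : 'X_{1..m}) : K :=
  \prod_(i < m) \prod_(1 <= k < (a i).+1) qnum q k.

Definition factm (m : nat) (a : 'X_{1..m}) : nat := \prod_(i < m) (a i)`!.

Definition qshift (N : nat) q (i : 'I_N) (f : {mpoly K[N]}) : {mpoly K[N]} :=
  f \mPo [tuple if j == i then q *: 'X_j else 'X_j | j < N].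

(* Quotient by 'X_i; terms not divisible by 'X_i are dropped (there are none
   in [qshift q i f - f], cf. [Dq_spec]). *)
Definition divX (N : nat) (i : 'I_N) (f : {mpoly K[N]}) : {mpoly K[N]} :=
  \sum_(mu <- msupp f | (0 < mu i)%N) f@_mu *: 'X_[(mu - U_(i))%MM].

Definition Dq (N : nat) q (i : 'I_N) (f : {mpoly K[N]}) : {mpoly K[N]} :=
  (q - 1)^-1 *: divX i (qshift q i f - f).

Definition diagX (N : nat) (c : 'X_{1..N} -> K) (f : {mpoly K[N]}) :
    {mpoly K[N]} :=
  \sum_(mu <- msupp f) (c mu * f@_mu) *: 'X_[mu].

End QCalculus.

(* [PP K m] is K[z_1..z_m, w_1..w_m] (x) /\ K^m: [F S] is the polynomial
   coefficient of e_S.  The variable z_i is ['X_(lshift m i)] and w_i is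
   ['X_(rshift m i)]. *)
Definition PP (K : fieldType) (m : nat) : lmodType K :=
  {ffun {set 'I_m} -> {mpoly K[m + m]}}.

Section Spaces.
Context {K : fieldType} {m : nat}.
Implicit Types (F : PP K m) (q : K) (i : 'I_m) (S T : {set 'I_m}).
Implicit Types (a b : 'X_{1..m}) (mu : 'X_{1..m + m}).

Definition zvar i : {mpoly K[m + m]} := 'X_(lshift m i).
Definition wvar i : {mpoly K[m + m]} := 'X_(rshift m i).

Definition zexp mu : 'X_{1..m} := [multinom mu (lshift m i) | i < m].
Definition wexp mu : 'X_{1..m} := [multinom mu (rshift m i) | i < m].

Definition zwe a b S : PP K m :=
  [ffun T => if T == S then
     (\prod_(i < m) zvar i ^+ a i) * (\prod_(i < m) wvar i ^+ b i) else 0].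

(* The degrees are integers, so that the space is 0 when r < 0, s < 0, n < 0
   or m < n (cf. [Prsn_eq0]). *)
Definition Prsn (r s n : int) : set (PP K m) :=
  lspan [set F | exists a b S,
    [/\ (mdeg a)%:Z = r, (mdeg b)%:Z = s, (#|S|)%:Z = n & F = zwe a b S]].

Definition onpoly (A : {mpoly K[m + m]} -> {mpoly K[m + m]}) F : PP K m :=
  [ffun S => A (F S)].

Definition Dz q i F : PP K m := onpoly (Dq q (lshift m i)) F.
Definition Dw q i F : PP K m := onpoly (Dq q (rshift m i)) F.
Definition mulz i F : PP K m := onpoly ( *%R (zvar i)) F.
Definition mulw i F : PP K m := onpoly ( *%R (wvar i)) F.

(* Coefficient of e_T in the exterior product of the i-th basis vector and
   e_S. *)
Definition ext_coef i S T : K :=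
  if (i \notin S) && (T == i |: S)%SET
  then (-1) ^+ #|[pred j in S | (j < i)%N]| else 0.

Definition eps i F : PP K m := [ffun T => \sum_S ext_coef i S T *: F S].

(* Adjoint of [eps i] for the inner product in which the e_S are orthonormal:
   the matrix of [eps i] has real entries and is transposed. *)
Definition iota i F : PP K m := [ffun S => \sum_T ext_coef i S T *: F T].

Definition calD q F : PP K m := \sum_(i < m) eps i (Dz q i F).
Definition calDd q F : PP K m := \sum_(i < m) iota i (Dw q i F).
Definition Delta q F : PP K m := \sum_(i < m) Dz q i (Dw q i F).

Definition Hrsn q (r s n : int) : set (PP K m) :=
  [set F | Delta q F = 0] `&` Prsn r s n.

Definition Mrsn q (r s n : int) : set (PP K m) :=
  [set F | calD q F = 0] `&` [set F | calDd q F = 0] `&` Prsn r s n.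

Definition Gcoef q mu : K :=
  ((factm (zexp mu))%:R * (factm (wexp mu))%:R)
  / (qfactm q (zexp mu) * qfactm q (wexp mu)).

Definition Gq q F : PP K m := onpoly (diagX (Gcoef q)) F.
(* Inverse of [Gq q] when 0 < q < 1, cf. [GqK] and [Gcoef_neq0]. *)
Definition Gqinv q F : PP K m := onpoly (diagX (fun mu => (Gcoef q mu)^-1)) F.

Definition hatz q i F : PP K m := Gq q (mulz i (Gqinv q F)).
Definition hatw q i F : PP K m := Gq q (mulw i (Gqinv q F)).

Definition hatZ q F : PP K m := \sum_(i < m) iota i (hatz q i F).
Definition hatZd q F : PP K m := \sum_(i < m) eps i (hatw q i F).
Definition hatrho q F : PP K m := \sum_(i < m) hatz q i (hatw q i F).

Definition hatX q (a b n : int) F : PP K m :=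
  (a + n)%:~R *: hatZ q (hatZd q F)
  - (b + m%:Z - n)%:~R *: hatZd q (hatZ q F).

Definition Rterm q (r s n : int) (k : 'I_4) : set (PP K m) :=
  nth [set 0]
    [:: Mrsn q r s n;
        hatZ q @` Mrsn q (r - 1) s (n + 1);
        hatZd q @` Mrsn q r (s - 1) (n - 1);
        if (1 <= n <= m%:Z - 1)
        then hatX q (r - 1) (s - 1) n @` Mrsn q (r - 1) (s - 1) n
        else [set 0]] k.

Definition Rrsn q (r s n : int) : set (PP K m) := sumset (Rterm q r s n).

End Spaces.

Section SpanFacts.
Context {K : fieldType} {V : lmodType K}.
Implicit Types (B : set V) (x y : V).

Lemma lspan0 B : lspan B 0.
Proof.
exists 0%N, (fun=> 0), (fun=> 0).
by split; [case | rewrite big_ord0].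
Qed.

Lemma lspan_scale B c x : B x -> lspan B (c *: x).
Proof.
by move=> Bx; exists 1%N, (fun=> c), (fun=> x); split; rewrite ?big_ord1.
Qed.

Lemma lspanD B x y : lspan B x -> lspan B y -> lspan B (x + y).
Proof.
move=> [k [c [v [hv ->]]]] [l [d [w [hw ->]]]].
exists (k + l)%N.
exists (fun i => match fintype.split i with inl j => c j | inr j => d j end).
exists (fun i => match fintype.split i with inl j => v j | inr j => w j end).
split=> [i|]; first by case: fintype.split.
rewrite big_split_ord /=; congr (_ + _); apply: eq_bigr => i _.
  by rewrite -[lshift l i]/(unsplit (inl i)) unsplitK.
by rewrite -[rshift k i]/(unsplit (inr i)) unsplitK.
Qed.

Lemma lspan_sum (I : eqType) (t : seq I) B (f : I -> V) :
  (forall i, i \in t -> lspan B (f i)) -> lspan B (\sum_(i <- t) f i).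
Proof.
move=> h; rewrite big_seq_cond; elim/big_ind: _ => [|x y|i /andP[it _]].
- exact: lspan0.
- exact: lspanD.
- exact: h.
Qed.
End SpanFacts.

Section Facts.
Context {K : fieldType}.
Implicit Types q : K.

Lemma mcoeff_divX N (i : 'I_N) (f : {mpoly K[N]}) nu :
  (divX i f)@_nu = f@_(nu + U_(i))%MM.
Proof.
rewrite /divX raddf_sum /=.
have [h|h] := boolP ((nu + U_(i))%MM \in msupp f); last first.
  rewrite (memN_msupp_eq0 h) big1_seq // => mu /andP[mui muf].
  rewrite mcoeffZ mcoeffX; case: eqP => [e|_]; last by rewrite mulr0.
  by move: h; rewrite -e submK ?muf // lep1mP -lt0n.
rewrite big_mkcond (bigD1_seq (nu + U_(i))%MM) ?msupp_uniq //=.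
rewrite mnmDE mnm1E eqxx addn1 /= mcoeffZ mcoeffX addmK eqxx mulr1.
rewrite big1_seq ?addr0 // => mu /andP[ne muf].
case: ifP => // mui; rewrite mcoeffZ mcoeffX.
case: eqP => [e|_]; last by rewrite mulr0.
by case/eqP: ne; rewrite -e submK // lep1mP -lt0n.
Qed.

Lemma mcoeff_qshift N q (i : 'I_N) (f : {mpoly K[N]}) nu :
  (qshift q i f)@_nu = q ^+ nu i * f@_nu.
Proof.
have hX mu : qshift q i 'X_[mu] = q ^+ mu i *: 'X_[mu].
  rewrite /qshift comp_mpolyX mpolyXE_id.
  under eq_bigr do rewrite tnth_mktuple.
  rewrite (bigD1 i) //= eqxx exprZn [X in _ = _ *: X](bigD1 i) //= scalerAl.
  by congr (_ * _); apply: eq_bigr => j /negbTE ->.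
rewrite {1}[f]mpolyE [qshift _ _ _]raddf_sum /= raddf_sum /=.
under eq_bigr => mu _.
  rewrite comp_mpolyZ -/(qshift q i 'X_[mu]) hX scalerA mcoeffZ mcoeffX.
  over.
have [h|h] := boolP (nu \in msupp f).
  rewrite (bigD1_seq nu) ?msupp_uniq //= eqxx mulr1 big1 ?addr0 1?mulrC // => mu.
  by move/negbTE ->; rewrite mulr0.
rewrite (memN_msupp_eq0 h) mulr0 big1_seq // => mu /= muf.
by case: eqP => [e|_]; rewrite ?mulr0 //; rewrite -e muf in h.
Qed.

Lemma mcoeff_Dq N q (i : 'I_N) (f : {mpoly K[N]}) nu :
  (Dq q i f)@_nu = qnum q (nu i).+1 * f@_(nu + U_(i))%MM.
Proof.
rewrite /Dq mcoeffZ mcoeff_divX mcoeffB mcoeff_qshift mnmDE mnm1E eqxx addn1.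
set c := f@_ _; have -> : q ^+ (nu i).+1 * c - c = (q ^+ (nu i).+1 - 1) * c.
  by rewrite mulrBl mul1r.
rewrite mulrA; congr (_ * _).
by rewrite mulrC /qnum -(opprB 1 (q ^+ _)) -(opprB 1 q) invrN mulrNN.
Qed.

Lemma Dq_spec N q (i : 'I_N) (f : {mpoly K[N]}) : q != 1 ->
  (q - 1) *: ('X_i * Dq q i f) = qshift q i f - f.
Proof.
move=> q1; rewrite /Dq -scalerAr scalerA mulfV ?subr_eq0 // scale1r.
set g := _ - f.
apply/mpolyP=> mu; have [mui|mui] := posnP (mu i).
  rewrite /g mcoeffB mcoeff_qshift mui expr0 mul1r subrr.
  rewrite mulrC memN_msupp_eq0 // (perm_mem (msuppMX _ _)).
  by apply/negP=> /mapP[nu _ e]; move: mui; rewrite e mnmDE mnm1E eqxx.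
have -> : mu = (mu - U_(i) + U_(i))%MM by rewrite submK // lep1mP -lt0n.
by rewrite mulrC addmC mcoeffMX mcoeff_divX addmC.
Qed.

Lemma mcoeff_diagX N (c : 'X_{1..N} -> K) (f : {mpoly K[N]}) nu :
  (diagX c f)@_nu = c nu * f@_nu.
Proof.
rewrite /diagX raddf_sum /=.
have [h|h] := boolP (nu \in msupp f); last first.
  rewrite (memN_msupp_eq0 h) mulr0 big1_seq // => mu /= muf.
  rewrite mcoeffZ mcoeffX; case: eqP => [e|_]; last by rewrite mulr0.
  by rewrite -e muf in h.
rewrite (bigD1_seq nu) ?msupp_uniq //= mcoeffZ mcoeffX eqxx mulr1.
rewrite big1 ?addr0 // => mu /negbTE ne.
by rewrite mcoeffZ mcoeffX ne mulr0.
Qed.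

Context {m : nat}.
Implicit Types (F : PP K m) (i : 'I_m) (S : {set 'I_m}).
Implicit Types (a b : 'X_{1..m}) (mu : 'X_{1..m + m}).

Lemma zweE a b S T : zwe a b S T =
  if T == S then 'X_[[multinom of a ++ b]] else 0 :> {mpoly K[m + m]}.
Proof.
rewrite ffunE; case: eqP => // _.
rewrite mpolyXE_id big_split_ord /=; congr (_ * _); apply: eq_bigr => i _.
  by rewrite multinomE (tnth_lshift a b i).
by rewrite multinomE (tnth_rshift a b i).
Qed.

Lemma zexp_cat a b : zexp [multinom of a ++ b] = a.
Proof. by apply/mnmP=> i; rewrite mnmE multinomE (tnth_lshift a b i). Qed.

Lemma wexp_cat a b : wexp [multinom of a ++ b] = b.
Proof. by apply/mnmP=> i; rewrite mnmE multinomE (tnth_rshift a b i). Qed.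

Lemma cat_exp mu : [multinom of zexp mu ++ wexp mu] = mu.
Proof.
apply/mnmP=> k; rewrite multinomE; case: (split_ordP k) => i ->.
  by rewrite (tnth_lshift (zexp mu) (wexp mu) i) tnth_mktuple.
by rewrite (tnth_rshift (zexp mu) (wexp mu) i) tnth_mktuple.
Qed.

Lemma eps_zwe i a b S : eps i (zwe a b S : PP K m) =
  if i \in S then 0
  else (-1) ^+ #|[pred j in S | (j < i)%N]| *: zwe a b (i |: S)%SET.
Proof.
apply/ffunP=> T; rewrite ffunE (bigD1 S) //= big1 => [|U /negbTE US]; last first.
  by rewrite ffunE US scaler0.
rewrite addr0 /ext_coef; case: (i \in S) => /=; first by rewrite scale0r ffunE.
rewrite !ffunE eqxx; case: eqP => // _.
by rewrite scale0r scaler0.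
Qed.

Lemma iota_zwe i a b S : iota i (zwe a b S : PP K m) =
  if i \in S
  then (-1) ^+ #|[pred j in S | (j < i)%N]| *: zwe a b (S :\ i)%SET else 0.
Proof.
apply/ffunP=> T; rewrite ffunE (bigD1 S) //= big1 => [|U /negbTE US]; last first.
  by rewrite ffunE US scaler0.
rewrite addr0 /ext_coef.
have -> : (i \notin T) && (S == i |: T)%SET = (i \in S) && (T == S :\ i)%SET.
  apply/andP/andP=> -[h /eqP->]; split.
  - by rewrite !inE eqxx.
  - by rewrite finset.setU1K.
  - by rewrite !inE eqxx.
  - by rewrite finset.setD1K.
case: (boolP (i \in S)) => /= iS; last by rewrite scale0r ffunE.
rewrite !ffunE eqxx; case: eqP => [->|_]; last by rewrite scale0r scaler0.
congr (_ ^+ _ *: _); apply: eq_card => j; rewrite !inE.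
by case: (eqVneq j i) => [->|]; rewrite ?ltnn ?andbF.
Qed.

Lemma Gq_zwe q a b S : Gq q (zwe a b S : PP K m) =
  ((factm a)%:R * (factm b)%:R / (qfactm q a * qfactm q b)) *: zwe a b S.
Proof.
apply/ffunP=> T; apply/mpolyP=> nu.
have scE c (F : PP K m) : (c *: F) T = c *: F T by rewrite ffunE.
rewrite scE [Gq _ _ _]ffunE mcoeff_diagX mcoeffZ zweE; case: eqP => _; last first.
  by rewrite mcoeff0 !mulr0.
rewrite mcoeffX; case: eqP => [<-|_]; last by rewrite !mulr0.
congr (_ * _); rewrite /Gcoef.
by rewrite zexp_cat wexp_cat.
Qed.

Lemma GqK q : (forall mu, Gcoef q mu != 0) ->
  cancel (@Gq K m q) (Gqinv q) /\ cancel (@Gqinv K m q) (Gq q).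
Proof.
move=> h; split=> F; apply/ffunP=> T; apply/mpolyP=> nu;
  by rewrite !ffunE !mcoeff_diagX mulrA ?mulVf ?mulfV // mul1r.
Qed.

Lemma Prsn_coef (r s n : int) F : Prsn r s n F <->
  forall S mu, (F S)@_mu != 0 ->
    [/\ (mdeg (zexp mu))%:Z = r, (mdeg (wexp mu))%:Z = s & (#|S|)%:Z = n].
Proof.
split=> [[k [c [v [hv ->]]]] S mu | hF].
  rewrite sum_ffunE raddf_sum /= => h.
  have [i hi] : exists i : 'I_k, (v i S)@_mu != 0.
    apply/existsP; apply: contraNT h; rewrite negb_exists => /forallP h.
    rewrite big1 // => i _; rewrite ffunE mcoeffZ.
    by move/negbNE/eqP: (h i) => ->; rewrite mulr0.
  case: (hv i) => a [b [T [<- <- <- e]]]; move: hi; rewrite e zweE.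
  case: (eqVneq S T) => [->|_]; last by rewrite mcoeff0 eqxx.
  rewrite mcoeffX; case: (eqVneq _ mu) => [<- _|_]; last by rewrite eqxx.
  by rewrite zexp_cat wexp_cat.
have -> : F = \sum_S \sum_(mu <- msupp (F S))
                (F S)@_mu *: zwe (zexp mu) (wexp mu) S.
  apply/ffunP=> S; rewrite sum_ffunE (bigD1 S) //= [X in _ + X]big1 => [|T ne].
    rewrite addr0 sum_ffunE {1}[F S]mpolyE; apply: eq_bigr => mu _.
    by rewrite ffunE zweE eqxx cat_exp.
  rewrite sum_ffunE big1 // => mu _.
  by rewrite ffunE zweE eq_sym (negbTE ne) scaler0.
apply: lspan_sum => S _; apply: lspan_sum => mu.
rewrite mcoeff_msupp => /hF[h1 h2 h3].
apply: lspan_scale; exists (zexp mu), (wexp mu), S; by split.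
Qed.

Lemma Prsn_eq0 (r s n : int) :
  ~~ [&& 0 <= r, 0 <= s & 0 <= n <= m%:Z] -> @Prsn K m r s n = [set 0].
Proof.
move=> h; apply/seteqP; split=> F /=; last first.
  by move->; apply: lspan0.
move/Prsn_coef=> hF; apply/ffunP=> S; apply/mpolyP=> mu; rewrite ffunE mcoeff0.
apply/eqP; apply: contraNT h => /hF[<- <- <-] /=.
by rewrite lez_nat -[X in (_ <= X)%N]card_ord max_card.
Qed.
End Facts.

Lemma Gcoef_neq0 (K : numFieldType) (m : nat) (q : K) (mu : 'X_{1..m + m}) :
  0 < q < 1 -> Gcoef q mu != 0.
Proof.
move=> /andP[q0 q1].
have hf (a : 'X_{1..m}) : (factm a)%:R != 0 :> K.
  by rewrite pnatr_eq0 -lt0n prodn_gt0 // => i; apply: fact_gt0.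
have hq (a : 'X_{1..m}) : qfactm q a != 0.
  apply/prodf_neq0 => i _; rewrite prodf_seq_neq0; apply/allP => k.
  rewrite mem_index_iota => /andP[k0 _] /=.
  rewrite mulf_neq0 ?invr_eq0 ?subr_eq0 1?eq_sym ?lt_eqF //.
  by rewrite exprn_ilt1 ?ltW // -lt0n.
by rewrite mulf_neq0 ?invr_eq0 ?mulf_neq0.
Qed.

(* Main.v *)
(** Conjugation by G_q makes D_{q,x} and multiplication by x-hat satisfy the
    Weyl relation [D_{q,x_i}, x_j-hat] = delta_ij.  With the anticommutation
    relations of the exterior algebra this gives, on polynomial degree (r, s)
    and spin degree n,
      {D, Z} = r + n,  {D+, Z+} = s + m - n,  {D, Z+} = {D+, Z} = 0,
      D^2 = D+^2 = 0,  Delta = {D, D+},  rho = {Z, Z+},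
    and the rest of the argument only uses these relations.

    If Delta f = 0, then g = D D+ f = - D+ D f is monogenic of degree
    (r-1, s-1), and D D+ X h = - c h for monogenic h, with c > 0 when
    1 <= n <= m - 1; for n = 0 or n = m, g vanishes.  Subtracting a multiple of
    X g therefore makes D f and D+ f monogenic, and then
    f - Z (D f) / (r + n) - Z+ (D+ f) / (s + m - n) is monogenic.  Applying
    first D D+, then D and D+, shows that the sum is direct.

    For the second decomposition, [Delta, rho] = r + s + m, so that
    Delta rho^(j+1) h = (j+1) (a + b + m + j) rho^j h for h harmonic of degree
    (a, b), and one concludes by induction on min(r, s). *)

From HB Require Import structures.
Require Import Defs.
From mathcomp Require Import all_boot all_order all_algebra.
From mathcomp Require Import mpoly complex.
From mathcomp Require Import classical_sets reals.
From mathcomp Require Import zify ring.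

Set Implicit Arguments.
Unset Strict Implicit.
Unset Printing Implicit Defensive.

Import Order.TTheory GRing.Theory Num.Theory.
Local Open Scope classical_set_scope.
Local Open Scope ring_scope.

(* Unqualified, [iota] would be the one of [seq]. *)
Local Notation iota := Defs.iota.

(** * Creation and annihilation operators on the exterior algebra *)

Section Exterior.
Context {K : fieldType} {m : nat}.
Implicit Types (F : PP K m) (i j : 'I_m) (S T : {set 'I_m}).

(** The sign of moving the [i]-th basis vector past the factors of [e_S] that precede it, as in
    [ext_coef]. *)
Definition ext_sign i S : K := (-1) ^+ #|[pred j in S | (j < i)%N]|.

Lemma ext_signU1 i j S : j \notin S ->
  ext_sign i (j |: S)%SET = (-1) ^+ (j < i)%N * ext_sign i S.
Proof.
move=> jS; rewrite /ext_sign -exprD; congr (_ ^+ _).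
have e T : #|[pred k in T | (k < i)%N]| = (\sum_(k in T) (k < i))%N.
  by rewrite -sum1_card [RHS]big_mkcond [LHS]big_mkcond /=; apply: eq_bigr => k _;
     rewrite inE; case: (k \in T); case: (k < i)%N.
by rewrite !e big_setU1.
Qed.

Lemma ext_signD1 i j S : j \in S ->
  ext_sign i (S :\ j)%SET = (-1) ^+ (j < i)%N * ext_sign i S.
Proof.
move=> jS; rewrite -[in RHS](finset.setD1K jS) ext_signU1 ?inE ?eqxx //.
by rewrite mulrA -expr2 sqrr_sign mul1r.
Qed.

Lemma ext_sign_sq i S : ext_sign i S * ext_sign i S = 1.
Proof. by rewrite -expr2 sqrr_sign. Qed.

(** Row [T] of the matrix has at most one nonzero entry, in column [T :\ i]; removing [i] does not
    change the sign, since [i] is not counted before itself. *)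
Lemma eps_at i F T :
  eps i F T = if i \in T then ext_sign i T *: F (T :\ i)%SET else 0.
Proof.
rewrite ffunE; case: ifP => iT; last first.
  rewrite big1 // => S _; rewrite /ext_coef; case: ifP => [/andP[_ /eqP e]|_].
    by rewrite e !inE eqxx in iT.
  by rewrite scale0r.
rewrite (bigD1 (T :\ i)%SET) //= big1 => [|S ne].
  rewrite addr0 /ext_coef finset.setD1K // eqxx !inE eqxx /=.
  by rewrite -/(ext_sign i _) ext_signD1 // ltnn mul1r.
rewrite /ext_coef; case: ifP => [/andP[iS /eqP e]|_]; last by rewrite scale0r.
by rewrite e finset.setU1K ?eqxx in ne.
Qed.

Lemma iota_at i F S :
  iota i F S = if i \in S then 0 else ext_sign i S *: F (i |: S)%SET.
Proof.
rewrite ffunE; case: ifP => iS.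
  by rewrite big1 // => T _; rewrite /ext_coef iS scale0r.
rewrite (bigD1 (i |: S)%SET) //= big1 => [|T ne].
  by rewrite addr0 /ext_coef iS eqxx.
by rewrite /ext_coef (negbTE ne) andbF scale0r.
Qed.

(** Exactly one of [i < j] and [j < i] holds; the off-diagonal anticommutation signs all come from
    this. *)
Lemma sign_ltnC i j : i != j ->
  (-1) ^+ (j < i)%N = - (-1) ^+ (i < j)%N :> K.
Proof.
rewrite neq_ltn => /orP[] h; rewrite h ltnNge (ltnW h) /=;
 by rewrite expr0 expr1 ?opprK.
Qed.

Lemma eps_is_linear i : linear (@eps K m i).
Proof.
move=> a F G; apply/ffunP => S; rewrite !ffunE scaler_sumr -big_split /=.
by apply: eq_bigr => T _; rewrite !ffunE scalerDr !scalerA mulrC.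
Qed.
HB.instance Definition _ i :=
  GRing.isLinear.Build K (PP K m) (PP K m) _ (@eps K m i) (eps_is_linear i).

Lemma iota_is_linear i : linear (@iota K m i).
Proof.
move=> a F G; apply/ffunP => S; rewrite !ffunE scaler_sumr -big_split /=.
by apply: eq_bigr => T _; rewrite !ffunE scalerDr !scalerA mulrC.
Qed.
HB.instance Definition _ i :=
  GRing.isLinear.Build K (PP K m) (PP K m) _ (@iota K m i) (iota_is_linear i).

Lemma ext_sign_swap i j S : i \notin S -> j \notin S -> i != j ->
  ext_sign i (j |: S)%SET * ext_sign j S =
  - (ext_sign j (i |: S)%SET * ext_sign i S).
Proof.
by move=> iS jS ij; rewrite !ext_signU1 // (sign_ltnC ij) !mulNr mulrAC.
Qed.

Lemma iota_anticomm i j F : iota i (iota j F) + iota j (iota i F) = 0.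
Proof.
apply/ffunP => S; rewrite [LHS]ffunE [RHS]ffunE !iota_at !inE.
have [->|ij] := eqVneq i j.
  by case: ifP => //= _; rewrite ?orbT ?scaler0 ?addr0.
rewrite /=.
case: (boolP (i \in S)) => iS; case: (boolP (j \in S)) => jS;
  rewrite ?scaler0 ?addr0 //= ?scalerA.
rewrite finset.setUCA -scalerDl [X in X + _]mulrC [X in _ + X]mulrC.
by rewrite ext_sign_swap 1?eq_sym // addNr scale0r.
Qed.

Lemma eps_anticomm i j F : eps i (eps j F) + eps j (eps i F) = 0.
Proof.
apply/ffunP => T; rewrite [LHS]ffunE [RHS]ffunE !eps_at !inE.
have [->|ij] := eqVneq i j.
  by case: ifP => //= _; rewrite ?scaler0 ?addr0.
rewrite /=.
case: (boolP (i \in T)) => iT; case: (boolP (j \in T)) => jT;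
  rewrite ?scaler0 ?addr0 //= ?scalerA.
have -> : (T :\ j :\ i = T :\ i :\ j)%SET by rewrite !finset.setDDl finset.setUC.
rewrite -scalerDl !ext_signD1 // (sign_ltnC ij) mulNr.
by rewrite [X in X *: _](_ : _ = 0) ?scale0r //; ring.
Qed.

Lemma eps_iota_anticomm i j F :
  eps i (iota j F) + iota j (eps i F) = if i == j then F else 0.
Proof.
apply/ffunP => T; rewrite [LHS]ffunE eps_at !iota_at eps_at.
have [->|ij] := eqVneq i j.
  rewrite !inE eqxx /=; case: (boolP (j \in T)) => jT.
    by rewrite addr0 ext_signD1 // ltnn mul1r scalerA ext_sign_sq scale1r
               finset.setD1K.
  by rewrite add0r ext_signU1 // ltnn mul1r scalerA ext_sign_sq scale1r
             finset.setU1K.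
rewrite ffunE !inE /= (negbTE ij) [j == i]eq_sym (negbTE ij) /=.
case: (boolP (i \in T)) => iT; case: (boolP (j \in T)) => jT;
  rewrite ?scaler0 ?addr0 //= ?scalerA.
have -> : ((j |: T) :\ i = j |: (T :\ i))%SET.
  apply/setP => k; rewrite !inE; case: (eqVneq k j) => [->|] //=.
  by rewrite eq_sym ij.
rewrite -scalerDl ext_signD1 // ext_signU1 // (sign_ltnC ij) mulNr.
by rewrite [X in X *: _](_ : _ = 0) ?scale0r //; ring.
Qed.

Lemma eps_iota_at i F T : eps i (iota i F) T = if i \in T then F T else 0.
Proof.
rewrite eps_at iota_at !inE eqxx /=; case: ifP => // iT.
by rewrite scalerA ext_signD1 // ltnn mul1r ext_sign_sq scale1r finset.setD1K.
Qed.

(** Each [eps i (iota i _)] projects onto the [e_T] with [i] in [T], so the sum is the number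
    operator of the spin degree. *)
Lemma sum_eps_iota_at F T : (\sum_i eps i (iota i F)) T = F T *+ #|T|.
Proof.
rewrite sum_ffunE -sumr_const [RHS]big_mkcond /=.
by apply: eq_bigr => i _; rewrite eps_iota_at.
Qed.

Lemma eps_onpoly (A : {linear {mpoly K[m + m]} -> {mpoly K[m + m]}}) i F :
  eps i (onpoly A F) = onpoly A (eps i F).
Proof.
apply/ffunP => T; rewrite eps_at [RHS]ffunE eps_at ffunE.
by case: ifP => _; rewrite ?linear0 // linearZ.
Qed.

Lemma iota_onpoly (A : {linear {mpoly K[m + m]} -> {mpoly K[m + m]}}) i F :
  iota i (onpoly A F) = onpoly A (iota i F).
Proof.
apply/ffunP => T; rewrite iota_at [RHS]ffunE iota_at ffunE.
by case: ifP => _; rewrite ?linear0 // linearZ.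
Qed.

Lemma onpoly_is_linear (A : {linear {mpoly K[m + m]} -> {mpoly K[m + m]}}) :
  linear (onpoly A : PP K m -> PP K m).
Proof. by move=> a F G; apply/ffunP => T; rewrite !ffunE linearP. Qed.
End Exterior.

(** * Weyl relations for the q-derivatives and the conjugated multiplications *)

Section Weyl.
Context {K : numFieldType} {m : nat} (q : K).
Implicit Types (f g : {mpoly K[m + m]}) (mu nu : 'X_{1..m + m}) (k l : 'I_(m + m)).

Lemma mcoeffXM k f nu :
  ('X_k * f)@_nu = if (0 < nu k)%N then f@_(nu - U_(k))%MM else 0.
Proof.
rewrite mulrC; case: posnP => h.
  rewrite memN_msupp_eq0 // (perm_mem (msuppMX _ _)).
  by apply/negP=> /mapP[mu _ e]; move: h; rewrite e mnmDE mnm1E eqxx.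
have -> : nu = (U_(k) + (nu - U_(k)))%MM by rewrite addmC submK // lep1mP -lt0n.
by rewrite mcoeffMX [(U_(k) + _)%MM]addmC addmK.
Qed.

(** Splitting the coefficient over all [m + m] variables lets the [z] and [w] variables be treated
    alike. *)
Lemma Gcoef_prod mu : Gcoef q mu =
  \prod_k ((mu k)`!%:R / \prod_(1 <= l < (mu k).+1) qnum q l).
Proof.
rewrite /Gcoef /factm /qfactm !natr_prod big_split_ord /= -mulf_div -!prodf_div.
by congr (_ * _); apply: eq_bigr => i _; rewrite mnmE.
Qed.

Lemma GcoefDU mu k :
  Gcoef q (mu + U_(k))%MM = ((mu k).+1%:R / qnum q (mu k).+1) * Gcoef q mu.
Proof.
rewrite !Gcoef_prod (bigD1 k) //= [in RHS](bigD1 k) //= mulrA.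
rewrite mnmDE mnm1E eqxx addn1 factS natrM big_nat_recr //= mulf_div.
congr (_ / _ * _); first exact: mulrC.
by apply: eq_bigr => j jk; rewrite mnmDE mnm1E eq_sym (negbTE jk) addn0.
Qed.

(** The common form of [hatz] and [hatw] on one spinor component: [x^n] goes to [(n+1)/[n+1]_q
    x^(n+1)]. *)
Definition qmul k f :=
  diagX (Gcoef q) ('X_k * diagX (fun mu => (Gcoef q mu)^-1) f).

Context (hq : 0 < q < 1).

Lemma qnumS_neq0 n : qnum q n.+1 != 0.
Proof.
case/andP: hq => q0 q1.
rewrite mulf_neq0 ?invr_eq0 // subr_eq0 eq_sym lt_eqF // exprn_ilt1 // ltW //.
Qed.

(** The scalar is the ratio of two consecutive values of [Gcoef]. At [nu k = 0] the truncated
    exponent is harmless, because the factor [(nu k)%:R] vanishes. *)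
Lemma mcoeff_qmul k f nu :
  (qmul k f)@_nu = (nu k)%:R / qnum q (nu k) * f@_(nu - U_(k))%MM.
Proof.
rewrite mcoeff_diagX mcoeffXM; case: posnP => h; first by rewrite h mulr0 !mul0r.
rewrite mcoeff_diagX mulrA; congr (_ * _).
have e : (nu = nu - U_(k) + U_(k))%MM by rewrite submK // lep1mP -lt0n.
have h' : ((nu - U_(k))%MM k).+1 = nu k by rewrite {2}e mnmDE mnm1E eqxx addn1.
by rewrite {1}e GcoefDU h' mulfK // Gcoef_neq0.
Qed.

Lemma Dq_is_linear k : linear (Dq q k : {mpoly K[m + m]} -> _).
Proof.
move=> a f g; apply/mpolyP => nu.
by rewrite mcoeffD mcoeffZ !mcoeff_Dq mcoeffD mcoeffZ mulrDr mulrCA.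
Qed.
HB.instance Definition _ k :=
  GRing.isLinear.Build K {mpoly K[m + m]} {mpoly K[m + m]} _ (Dq q k) (Dq_is_linear k).

Lemma diagX_is_linear c : linear (diagX c : {mpoly K[m + m]} -> _).
Proof.
move=> a f g; apply/mpolyP => nu.
by rewrite mcoeffD mcoeffZ !mcoeff_diagX mcoeffD mcoeffZ mulrDr mulrCA.
Qed.
HB.instance Definition _ c :=
  GRing.isLinear.Build K {mpoly K[m + m]} {mpoly K[m + m]} _ (diagX c)
    (diagX_is_linear c).

Lemma qmul_is_linear k : linear (qmul k).
Proof. by move=> a f g; rewrite /qmul !linearP /= mulrDr -scalerAr linearP. Qed.
HB.instance Definition _ k :=
  GRing.isLinear.Build K {mpoly K[m + m]} {mpoly K[m + m]} _ (qmul k) (qmul_is_linear k).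

Lemma DqC k l f : Dq q k (Dq q l f) = Dq q l (Dq q k f).
Proof.
apply/mpolyP => nu; have e i j : (Dq q i (Dq q j f))@_nu =
    qnum q (nu i).+1 * (qnum q (nu j + (i == j)).+1 * f@_(nu + (U_(i) + U_(j)))%MM).
  rewrite mcoeff_Dq; congr (_ * _); rewrite addmA mcoeff_Dq.
  by rewrite mnmDE mnm1E.
apply: etrans (e k l) (etrans _ (esym (e l k))); rewrite (addmC U_(l)%MM).
have [->|kl] := eqVneq k l; first by [].
by rewrite !addn0 mulrCA.
Qed.

Lemma qmulC k l f : qmul k (qmul l f) = qmul l (qmul k f).
Proof.
have diagXK g : diagX (fun mu => (Gcoef q mu)^-1) (diagX (Gcoef q) g) = g.
  by apply/mpolyP => nu; rewrite !mcoeff_diagX mulKf // Gcoef_neq0.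
by rewrite /qmul !diagXK mulrCA.
Qed.

(** The q-numbers cancel: on [x^n], [Dq] after [qmul] multiplies by [n+1], and [qmul] after [Dq] by
    [n]. *)
Lemma Dq_qmul k l f :
  Dq q k (qmul l f) = qmul l (Dq q k f) + (if k == l then f else 0).
Proof.
apply/mpolyP => nu; rewrite mcoeffD mcoeff_Dq !mcoeff_qmul mcoeff_Dq.
have [->|kl] := eqVneq k l.
  rewrite mnmDE mnm1E eqxx addn1 addmK mulrA mulrCA divff ?qnumS_neq0 // mulr1.
  case: (posnP (nu l)) => h; first by rewrite h !mul0r add0r mul1r.
  rewrite submK ?lep1mP -?lt0n // mnmBE mnm1E eqxx subn1 prednK // mulrA.
  rewrite divfK; first by rewrite -natr1 mulrDl mul1r.
  by rewrite -(prednK h) qnumS_neq0.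
rewrite mcoeff0 addr0 mnmDE mnmBE !mnm1E (negbTE kl) eq_sym (negbTE kl).
rewrite addn0 subn0 mulrCA; congr (_ * (_ * f@_ _)).
(* For [k != l] the addition and the truncated subtraction touch different exponents, so they
   commute. *)
apply/mnmP => j; rewrite !(mnmDE, mnmBE) !mnm1E.
case: (eqVneq l j) kl => [<-|_ _]; rewrite ?subn0 //.
by move=> /negbTE ->; rewrite !addn0.
Qed.

Lemma qmul_Dq_at k f nu : (qmul k (Dq q k f))@_nu = (nu k)%:R * f@_nu.
Proof.
rewrite mcoeff_qmul mcoeff_Dq; case: (posnP (nu k)) => h; first by rewrite h !mul0r.
rewrite submK ?lep1mP -?lt0n // mnmBE mnm1E eqxx subn1 prednK // mulrA divfK //.
by rewrite -(prednK h) qnumS_neq0.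
Qed.
End Weyl.

(** * Exterior operators with polynomial operator coefficients *)

Section SpinorSums.
Context {K : numFieldType} {m : nat}.
Implicit Types (F : PP K m) (A B : 'I_m -> {linear {mpoly K[m + m]} -> {mpoly K[m + m]}}).

(** [calD] and [hatZd] have this form, [calDd] and [hatZ] that of [iota_sum]; their relations thus
    reduce to those between the coefficient operators. *)
Definition eps_sum A F : PP K m := \sum_i eps i (onpoly (A i) F).
Definition iota_sum A F : PP K m := \sum_i iota i (onpoly (A i) F).

Lemma eps_sum_is_linear A : linear (eps_sum A).
Proof.
move=> a F G; rewrite /eps_sum scaler_sumr -big_split /=; apply: eq_bigr => i _.
by rewrite onpoly_is_linear linearP.
Qed.
HB.instance Definition _ A :=
  GRing.isLinear.Build K (PP K m) (PP K m) _ (eps_sum A) (eps_sum_is_linear A).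

Lemma iota_sum_is_linear A : linear (iota_sum A).
Proof.
move=> a F G; rewrite /iota_sum scaler_sumr -big_split /=; apply: eq_bigr => i _.
by rewrite onpoly_is_linear linearP.
Qed.
HB.instance Definition _ A :=
  GRing.isLinear.Build K (PP K m) (PP K m) _ (iota_sum A) (iota_sum_is_linear A).

Lemma onpoly_comp (a b : {mpoly K[m + m]} -> {mpoly K[m + m]}) F :
  onpoly a (onpoly b F) = onpoly (a \o b) F.
Proof. by apply/ffunP => S; rewrite !ffunE. Qed.

Lemma onpoly_sum (a : {linear {mpoly K[m + m]} -> {mpoly K[m + m]}})
    (f : 'I_m -> PP K m) :
  onpoly a (\sum_i f i) = \sum_i onpoly a (f i).
Proof.
by apply/ffunP => S; rewrite ffunE !sum_ffunE linear_sum; apply: eq_bigr => i _;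
   rewrite ffunE.
Qed.

Lemma eps_sum2 A B F : eps_sum A (eps_sum B F) =
  \sum_i \sum_j eps i (eps j (onpoly (A i) (onpoly (B j) F))).
Proof.
apply: eq_bigr => i _; rewrite onpoly_sum linear_sum; apply: eq_bigr => j _.
by rewrite /= -eps_onpoly.
Qed.

Lemma iota_sum2 A B F : iota_sum A (iota_sum B F) =
  \sum_i \sum_j iota i (iota j (onpoly (A i) (onpoly (B j) F))).
Proof.
apply: eq_bigr => i _; rewrite onpoly_sum linear_sum; apply: eq_bigr => j _.
by rewrite /= -iota_onpoly.
Qed.

(** After exchanging the summation indices in one double sum, the polynomial parts agree and the
    exterior parts cancel term by term. *)
Lemma eps_sum_anticomm A B F : (forall i j f, A i (B j f) = B j (A i f)) ->
  eps_sum A (eps_sum B F) + eps_sum B (eps_sum A F) = 0.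
Proof.
move=> AB; rewrite !eps_sum2 [X in _ + X]exchange_big -big_split /=.
rewrite big1 // => i _; rewrite -big_split /= big1 // => j _.
rewrite [X in _ + eps j (eps i X)](_ : _ = onpoly (A i) (onpoly (B j) F)).
  exact: eps_anticomm.
by apply/ffunP => S; rewrite !ffunE AB.
Qed.

Lemma iota_sum_anticomm A B F : (forall i j f, A i (B j f) = B j (A i f)) ->
  iota_sum A (iota_sum B F) + iota_sum B (iota_sum A F) = 0.
Proof.
move=> AB; rewrite !iota_sum2 [X in _ + X]exchange_big -big_split /=.
rewrite big1 // => i _; rewrite -big_split /= big1 // => j _.
rewrite [X in _ + iota j (iota i X)](_ : _ = onpoly (A i) (onpoly (B j) F)).
  exact: iota_anticomm.
by apply/ffunP => S; rewrite !ffunE AB.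
Qed.

(* [c] is 1 for the pair (D, Z), -1 for (Z+, D+) and 0 for commuting families. *)
Lemma eps_iota_sum A B c F :
  (forall i j f, A i (B j f) = B j (A i f) + (if i == j then c *: f else 0)) ->
  eps_sum A (iota_sum B F) + iota_sum B (eps_sum A F) =
  \sum_i onpoly (B i) (onpoly (A i) F) + c *: \sum_i eps i (iota i F).
Proof.
move=> AB.
have -> : iota_sum B (eps_sum A F) =
    \sum_i \sum_j iota j (eps i (onpoly (B j) (onpoly (A i) F))).
  rewrite exchange_big; apply: eq_bigr => j _; rewrite onpoly_sum linear_sum.
  by apply: eq_bigr => i _; rewrite /= -eps_onpoly.
have -> : eps_sum A (iota_sum B F) =
    \sum_i \sum_j eps i (iota j (onpoly (A i) (onpoly (B j) F))).
  apply: eq_bigr => i _; rewrite onpoly_sum linear_sum.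
  by apply: eq_bigr => j _; rewrite /= -iota_onpoly.
rewrite scaler_sumr -!big_split /=; apply: eq_bigr => i _; rewrite -big_split /=.
have e j : onpoly (A i) (onpoly (B j) F) =
    onpoly (B j) (onpoly (A i) F) + (if i == j then c *: F else 0).
  by apply/ffunP => S; rewrite !ffunE AB; case: eqP => _; rewrite ffunE.
(* Once [A i] is moved past [B j], [eps i] and [iota j] anticommute, so only the diagonal terms
   survive. *)
transitivity (\sum_j (if i == j then
    onpoly (B j) (onpoly (A i) F) + c *: eps i (iota i F) else 0)); last first.
  rewrite (bigD1 i) //= eqxx big1 ?addr0 // => j; rewrite eq_sym => /negbTE -> //.
apply: eq_bigr => j _; rewrite e !linearD /= addrAC eps_iota_anticomm.
by case: eqP => [<-|_]; rewrite ?linearZ ?linear0 ?addr0.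
Qed.
End SpinorSums.

(** * Multidegrees and Euler operators *)

Section Degrees.
Context {K : numFieldType} {m : nat} (q : K).
Implicit Types (F G : PP K m) (i : 'I_m) (r s n : int).
Local Notation P := (@Prsn K m).

Lemma zexpD (mu nu : 'X_{1..m + m}) : zexp (mu + nu) = (zexp mu + zexp nu)%MM.
Proof. by apply/mnmP => i; rewrite !mnmE. Qed.

Lemma wexpD (mu nu : 'X_{1..m + m}) : wexp (mu + nu) = (wexp mu + wexp nu)%MM.
Proof. by apply/mnmP => i; rewrite !mnmE. Qed.

Lemma zexpUl i : zexp (U_(lshift m i))%MM = U_(i)%MM.
Proof. by apply/mnmP => j; rewrite mnmE !mnm1E eq_lshift. Qed.

Lemma zexpUr i : zexp (U_(rshift m i))%MM = 0%MM.
Proof. by apply/mnmP => j; rewrite mnmE mnm1E eq_rlshift mnm0E. Qed.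

Lemma wexpUl i : wexp (U_(lshift m i))%MM = 0%MM.
Proof. by apply/mnmP => j; rewrite mnmE mnm1E eq_lrshift mnm0E. Qed.

Lemma wexpUr i : wexp (U_(rshift m i))%MM = U_(i)%MM.
Proof. by apply/mnmP => j; rewrite mnmE !mnm1E eq_rshift. Qed.

Let expE := (zexpD, wexpD, zexpUl, zexpUr, wexpUl, wexpUr, @mdegD m, @mdeg0 m, @mdeg1 m).

Lemma PP_scaleE a F S : (a *: F) S = a *: F S.
Proof. by rewrite ffunE. Qed.

Lemma Prsn0 r s n : P r s n 0.
Proof. exact: lspan0. Qed.

Lemma PrsnD r s n F G : P r s n F -> P r s n G -> P r s n (F + G).
Proof. exact: lspanD. Qed.

Lemma PrsnZ r s n a F : P r s n F -> P r s n (a *: F).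
Proof.
move/Prsn_coef => hF; apply/Prsn_coef => S mu; rewrite ffunE mcoeffZ => h.
by apply: hF; apply: contraNneq h => ->; rewrite mulr0.
Qed.

Lemma Prsn_sum r s n (I : eqType) (t : seq I) (f : I -> PP K m) :
  (forall k, P r s n (f k)) -> P r s n (\sum_(k <- t) f k).
Proof. by move=> h; apply: lspan_sum => k _; apply: h. Qed.

Lemma Prsn_eps r s n i F : P r s n F -> P r s (n + 1) (eps i F).
Proof.
move/Prsn_coef => hF; apply/Prsn_coef => S mu; rewrite eps_at.
case: ifP => iS; last by rewrite mcoeff0 eqxx.
rewrite mcoeffZ mulf_eq0 negb_or => /andP[_ /hF[-> -> <-]]; split => //.
by rewrite (cardsD1 i S) iS addrC PoszD.
Qed.

Lemma Prsn_iota r s n i F : P r s n F -> P r s (n - 1) (iota i F).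
Proof.
move/Prsn_coef => hF; apply/Prsn_coef => S mu; rewrite iota_at.
case: ifP => iS; first by rewrite mcoeff0 eqxx.
rewrite mcoeffZ mulf_eq0 negb_or => /andP[_ /hF[-> -> <-]]; split => //.
by rewrite cardsU1 iS PoszD addrC addKr.
Qed.

Lemma Prsn_Dz r s n i F : P r s n F -> P (r - 1) s n (Dz q i F).
Proof.
move/Prsn_coef => hF; apply/Prsn_coef => S mu; rewrite ffunE mcoeff_Dq.
rewrite mulf_eq0 negb_or => /andP[_ /hF[<- <- <-]]; rewrite !expE.
by rewrite addn0 PoszD addrK.
Qed.

Lemma Prsn_Dw r s n i F : P r s n F -> P r (s - 1) n (Dw q i F).
Proof.
move/Prsn_coef => hF; apply/Prsn_coef => S mu; rewrite ffunE mcoeff_Dq.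
rewrite mulf_eq0 negb_or => /andP[_ /hF[<- <- <-]]; rewrite !expE.
by rewrite addn0 PoszD addrK.
Qed.

Lemma hatzE i F : hatz q i F = onpoly (qmul q (lshift m i)) F.
Proof. by apply/ffunP => S; rewrite !ffunE. Qed.

Lemma hatwE i F : hatw q i F = onpoly (qmul q (rshift m i)) F.
Proof. by apply/ffunP => S; rewrite !ffunE. Qed.

Context (hq : 0 < q < 1).

Lemma Prsn_hatz r s n i F : P r s n F -> P (r + 1) s n (hatz q i F).
Proof.
rewrite hatzE; move/Prsn_coef => hF; apply/Prsn_coef => S mu.
rewrite ffunE mcoeff_qmul //; have [->|mu0] := posnP (mu (lshift m i)).
  by rewrite !mul0r eqxx.
rewrite mulf_eq0 negb_or => /andP[_ /hF[<- <- <-]].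
have e : (mu = mu - U_(lshift m i) + U_(lshift m i))%MM.
  by rewrite submK // lep1mP -lt0n.
(* Occurrences 1 and 3 are those of [mu] outside [mu - U_(lshift m i)]. *)
by rewrite {1 3}e !expE addn0 PoszD.
Qed.

Lemma Prsn_hatw r s n i F : P r s n F -> P r (s + 1) n (hatw q i F).
Proof.
rewrite hatwE; move/Prsn_coef => hF; apply/Prsn_coef => S mu.
rewrite ffunE mcoeff_qmul //; have [->|mu0] := posnP (mu (rshift m i)).
  by rewrite !mul0r eqxx.
rewrite mulf_eq0 negb_or => /andP[_ /hF[<- <- <-]].
have e : (mu = mu - U_(rshift m i) + U_(rshift m i))%MM.
  by rewrite submK // lep1mP -lt0n.
by rewrite {1 3}e !expE addn0 PoszD.
Qed.

Lemma Prsn_calD r s n F : P r s n F -> P (r - 1) s (n + 1) (calD q F).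
Proof. by move=> h; apply: Prsn_sum => i; apply/Prsn_eps/Prsn_Dz. Qed.

Lemma Prsn_calDd r s n F : P r s n F -> P r (s - 1) (n - 1) (calDd q F).
Proof. by move=> h; apply: Prsn_sum => i; apply/Prsn_iota/Prsn_Dw. Qed.

Lemma Prsn_hatZ r s n F : P r s n F -> P (r + 1) s (n - 1) (hatZ q F).
Proof. by move=> h; apply: Prsn_sum => i; apply/Prsn_iota/Prsn_hatz. Qed.

Lemma Prsn_hatZd r s n F : P r s n F -> P r (s + 1) (n + 1) (hatZd q F).
Proof. by move=> h; apply: Prsn_sum => i; apply/Prsn_eps/Prsn_hatw. Qed.

(** In each variable [hatz] after [Dz] multiplies a monomial by its exponent, as in the undeformed
    Euler identity. *)
Lemma sum_hatz_Dz r s n F :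
  P r s n F -> \sum_i hatz q i (Dz q i F) = r%:~R *: F.
Proof.
move/Prsn_coef => hF; apply/ffunP => S; apply/mpolyP => mu.
rewrite sum_ffunE raddf_sum PP_scaleE mcoeffZ /=.
under eq_bigr => i _ do
  rewrite hatzE onpoly_comp ffunE /= qmul_Dq_at // -(mnmE (fun i => mu (lshift m i))).
rewrite -mulr_suml -natr_sum -mdegE -/(zexp mu).
(* The degree is known only where the coefficient is nonzero; elsewhere both sides are zero. *)
have [->|/hF[<- _ _]//] := eqVneq (F S)@_mu 0; by rewrite !mulr0.
Qed.

Lemma sum_hatw_Dw r s n F :
  P r s n F -> \sum_i hatw q i (Dw q i F) = s%:~R *: F.
Proof.
move/Prsn_coef => hF; apply/ffunP => S; apply/mpolyP => mu.
rewrite sum_ffunE raddf_sum PP_scaleE mcoeffZ /=.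
under eq_bigr => i _ do
  rewrite hatwE onpoly_comp ffunE /= qmul_Dq_at // -(mnmE (fun i => mu (rshift m i))).
rewrite -mulr_suml -natr_sum -mdegE -/(wexp mu).
have [->|/hF[_ <- _]//] := eqVneq (F S)@_mu 0; by rewrite !mulr0.
Qed.

Lemma sum_eps_iota r s n F :
  P r s n F -> \sum_i eps i (iota i F) = n%:~R *: F.
Proof.
move/Prsn_coef => hF; apply/ffunP => S; apply/mpolyP => mu.
rewrite sum_eps_iota_at PP_scaleE mcoeffMn mcoeffZ -mulr_natl.
by have [->|/hF[_ _ <-]//] := eqVneq (F S)@_mu 0; rewrite !mulr0.
Qed.
End Degrees.

(** * Commutation relations between the four spinor operators *)

Section Relations.
Context {K : numFieldType} {m : nat} (q : K).
Implicit Types (F : PP K m) (r s n : int).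
Local Notation P := (@Prsn K m).
Local Notation dz i := (Dq q (lshift m i) : {linear _ -> _}).
Local Notation dw i := (Dq q (rshift m i) : {linear _ -> _}).
Local Notation xz i := (qmul q (lshift m i) : {linear _ -> _}).
Local Notation xw i := (qmul q (rshift m i) : {linear _ -> _}).

Lemma calDE F : calD q F = eps_sum (fun i => dz i) F.
Proof. by []. Qed.

Lemma calDdE F : calDd q F = iota_sum (fun i => dw i) F.
Proof. by []. Qed.

Lemma hatZE F : hatZ q F = iota_sum (fun i => xz i) F.
Proof. by apply: eq_bigr => i _; rewrite hatzE. Qed.

Lemma hatZdE F : hatZd q F = eps_sum (fun i => xw i) F.
Proof. by apply: eq_bigr => i _; rewrite hatwE. Qed.

Lemma calD_is_linear : linear (@calD K m q).
Proof. by move=> a F G; rewrite !calDE linearP. Qed.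
HB.instance Definition _ :=
  GRing.isLinear.Build K (PP K m) (PP K m) _ (@calD K m q) calD_is_linear.

Lemma calDd_is_linear : linear (@calDd K m q).
Proof. by move=> a F G; rewrite !calDdE linearP. Qed.
HB.instance Definition _ :=
  GRing.isLinear.Build K (PP K m) (PP K m) _ (@calDd K m q) calDd_is_linear.

Lemma hatZ_is_linear : linear (@hatZ K m q).
Proof. by move=> a F G; rewrite !hatZE linearP. Qed.
HB.instance Definition _ :=
  GRing.isLinear.Build K (PP K m) (PP K m) _ (@hatZ K m q) hatZ_is_linear.

Lemma hatZd_is_linear : linear (@hatZd K m q).
Proof. by move=> a F G; rewrite !hatZdE linearP. Qed.
HB.instance Definition _ :=
  GRing.isLinear.Build K (PP K m) (PP K m) _ (@hatZd K m q) hatZd_is_linear.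

(** Characteristic zero: an operator that anticommutes with itself has square zero. *)
Lemma double_eq0 F : F + F = 0 -> F = 0.
Proof.
move=> /eqP; rewrite -mulr2n -scaler_nat scaler_eq0 pnatr_eq0 /=.
by move/eqP.
Qed.

Lemma calD_sq F : calD q (calD q F) = 0.
Proof. by apply/double_eq0/eps_sum_anticomm => i j f; apply: DqC. Qed.

Lemma calDd_sq F : calDd q (calDd q F) = 0.
Proof. by apply/double_eq0/iota_sum_anticomm => i j f; apply: DqC. Qed.

(** All q-derivatives commute, so the exterior anticommutators leave just the diagonal terms, whose
    sum is the Laplacian. *)
Lemma calD_calDd F : calD q (calDd q F) + calDd q (calD q F) = Delta q F.
Proof.
rewrite !calDE !calDdE (@eps_iota_sum _ _ _ _ 0) => [|i j f]; last first.
  by rewrite scale0r if_same addr0; apply: DqC.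
rewrite scale0r addr0; apply: eq_bigr => i _.
apply/ffunP => S; rewrite [LHS]ffunE [RHS]ffunE.
by rewrite [in LHS]ffunE [in RHS]ffunE DqC.
Qed.

Lemma Delta_is_linear : linear (@Delta K m q).
Proof.
move=> a F G; rewrite -!calD_calDd !linearP /= addrACA scalerDr.
by rewrite addrACA.
Qed.
HB.instance Definition _ :=
  GRing.isLinear.Build K (PP K m) (PP K m) _ (@Delta K m q) Delta_is_linear.

Lemma hatrho_is_linear : linear (@hatrho K m q).
Proof.
move=> a F G; rewrite /hatrho scaler_sumr -big_split /=; apply: eq_bigr => i _.
by rewrite !hatzE !hatwE !onpoly_is_linear.
Qed.
HB.instance Definition _ :=
  GRing.isLinear.Build K (PP K m) (PP K m) _ (@hatrho K m q) hatrho_is_linear.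

Context (hq : 0 < q < 1).

(** The [z]-derivatives commute with every [hatw], as they concern disjoint sets of variables. *)
Lemma calD_hatZd F : calD q (hatZd q F) = - hatZd q (calD q F).
Proof.
apply/eqP; rewrite -addr_eq0 !calDE !hatZdE eps_sum_anticomm // => i j f.
by rewrite /= Dq_qmul // eq_lrshift addr0.
Qed.

Lemma calDd_hatZ F : calDd q (hatZ q F) = - hatZ q (calDd q F).
Proof.
apply/eqP; rewrite -addr_eq0 !calDdE !hatZE iota_sum_anticomm // => i j f.
by rewrite /= Dq_qmul // eq_rlshift addr0.
Qed.

Lemma hatZ_hatZd F : hatZ q (hatZd q F) + hatZd q (hatZ q F) = hatrho q F.
Proof.
rewrite addrC !hatZE !hatZdE (@eps_iota_sum _ _ _ _ 0) => [|i j f]; last first.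
  by rewrite scale0r if_same addr0; apply: qmulC.
by rewrite scale0r addr0; apply: eq_bigr => i _; rewrite hatzE hatwE.
Qed.

(** The diagonal terms form the Euler operator, giving [r]; the Weyl commutator brings in the number
    operator, giving [n]. *)
Lemma calD_hatZ r s n F : P r s n F ->
  calD q (hatZ q F) = (r + n)%:~R *: F - hatZ q (calD q F).
Proof.
move=> hF; apply/eqP; rewrite eq_sym subr_eq eq_sym.
rewrite !calDE !hatZE (@eps_iota_sum _ _ _ _ 1) => [|i j f]; last first.
  by rewrite scale1r /= Dq_qmul // eq_lshift.
rewrite scale1r intrD scalerDl -(sum_hatz_Dz hq hF) (sum_eps_iota hF).
by apply/eqP; congr (_ + _); apply: eq_bigr => i _; rewrite hatzE.
Qed.

Lemma calDd_hatZd r s n F : P r s n F ->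
  calDd q (hatZd q F) = (s + m%:Z - n)%:~R *: F - hatZd q (calDd q F).
Proof.
move=> hF; apply/eqP; rewrite eq_sym subr_eq eq_sym addrC.
(* With [hatw] as first family and [Dw] as second, the Weyl commutator has sign [-1] and contributes
   [-n]. *)
rewrite !calDdE !hatZdE (@eps_iota_sum _ _ _ _ (-1)) => [|i j f]; last first.
  rewrite /= Dq_qmul // eq_rshift eq_sym.
  by case: eqP => _; rewrite ?addr0 // scaleN1r addrK.
rewrite scaleN1r !intrD scalerDl scalerDl (sum_eps_iota hF) -scaleNr -intrN.
apply/eqP; congr (_ + _); rewrite -(sum_hatw_Dw hq hF).
(* In the diagonal sum the derivative is outermost; reversing the order adds one [F] for each index,
   whence [s + m]. *)
transitivity (\sum_(i < m) (hatw q i (Dw q i F) + F)); last first.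
  by rewrite big_split /= sumr_const card_ord -scaler_nat.
apply: eq_bigr => i _; apply/ffunP => S.
by rewrite hatwE !ffunE /= Dq_qmul // eqxx.
Qed.
End Relations.

(** * Decompositions derived from the abstract relations *)

Section AbstractDecomposition.
Context {K : numFieldType} {V : lmodType K} (m : nat).
Context (D Dd Z Zd : {linear V -> V}) (P : int -> int -> int -> set V).

(** [sr_DZ] and [sr_DdZd] are stated degree by degree because their scalars depend on the degree;
    [sr_out] settles the boundary degrees, where a scalar may vanish. *)
Record spin_relations : Prop := SpinRelations {
  sr_P0 : forall r s n, P r s n 0;
  sr_PD : forall r s n x y, P r s n x -> P r s n y -> P r s n (x + y);
  sr_PZ : forall r s n c x, P r s n x -> P r s n (c *: x);
  sr_out : forall r s n x,
    ~~ [&& 0 <= r, 0 <= s & 0 <= n <= m%:Z] -> P r s n x -> x = 0;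
  sr_D : forall r s n x, P r s n x -> P (r - 1) s (n + 1) (D x);
  sr_Dd : forall r s n x, P r s n x -> P r (s - 1) (n - 1) (Dd x);
  sr_Z : forall r s n x, P r s n x -> P (r + 1) s (n - 1) (Z x);
  sr_Zd : forall r s n x, P r s n x -> P r (s + 1) (n + 1) (Zd x);
  sr_DD : forall x, D (D x) = 0;
  sr_DdDd : forall x, Dd (Dd x) = 0;
  sr_DZd : forall x, D (Zd x) = - Zd (D x);
  sr_DdZ : forall x, Dd (Z x) = - Z (Dd x);
  sr_DZ : forall r s n x, P r s n x -> D (Z x) = (r + n)%:~R *: x - Z (D x);
  sr_DdZd : forall r s n x, P r s n x ->
    Dd (Zd x) = (s + m%:Z - n)%:~R *: x - Zd (Dd x) }.

Context (sr : spin_relations).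
Implicit Types (x y h u v : V) (r s n a b : int).

Definition aDelta x := D (Dd x) + Dd (D x).
Definition arho x := Z (Zd x) + Zd (Z x).
Definition aX a b n x :=
  (a + n)%:~R *: Z (Zd x) - (b + m%:Z - n)%:~R *: Zd (Z x).
Definition aM r s n := [set x | D x = 0] `&` [set x | Dd x = 0] `&` P r s n.
Definition aH r s n := [set x | aDelta x = 0] `&` P r s n.
Definition aXterm r s n : set V :=
  if 1 <= n <= m%:Z - 1 then aX (r - 1) (s - 1) n @` aM (r - 1) (s - 1) n
  else [set 0].
Definition aRterm r s n (k : 'I_4) : set V :=
  nth [set 0]
    [:: aM r s n; Z @` aM (r - 1) s (n + 1); Zd @` aM r (s - 1) (n - 1);
        aXterm r s n] k.

Lemma aDelta_is_linear : linear aDelta.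
Proof. by move=> c x y; rewrite /aDelta !linearP /= scalerDr addrACA. Qed.
HB.instance Definition _ := GRing.isLinear.Build K V V _ aDelta aDelta_is_linear.

Lemma arho_is_linear : linear arho.
Proof. by move=> c x y; rewrite /arho !linearP /= scalerDr addrACA. Qed.
HB.instance Definition _ := GRing.isLinear.Build K V V _ arho arho_is_linear.

Lemma P_sub r s n x y : P r s n x -> P r s n y -> P r s n (x - y).
Proof.
by move=> px py; rewrite -scaleN1r; apply: (sr_PD sr) => //; apply: (sr_PZ sr).
Qed.

Lemma P_sum r s n (I : Type) (t : seq I) (f : I -> V) :
  (forall i, P r s n (f i)) -> P r s n (\sum_(i <- t) f i).
Proof.
move=> h; elim/big_ind: _ => // [|x y]; [exact: (sr_P0 sr) | exact: (sr_PD sr)].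
Qed.

Lemma aM0 r s n : aM r s n 0.
Proof. by split; [split; apply: linear0 | apply: (sr_P0 sr)]. Qed.

Lemma aMZ r s n c x : aM r s n x -> aM r s n (c *: x).
Proof.
move=> [[/= dx ddx] px]; split; last exact: (sr_PZ sr).
by split; rewrite /= linearZ /= ?dx ?ddx scaler0.
Qed.

Lemma aM_out r s n x :
  ~~ [&& 0 <= r, 0 <= s & 0 <= n <= m%:Z] -> aM r s n x -> x = 0.
Proof. by move=> o [_ /(sr_out sr)]; apply. Qed.

(** * Action of the derivatives on images of monogenic elements *)

Lemma DZ_M r s n h : aM r s n h -> D (Z h) = (r + n)%:~R *: h.
Proof. by move=> [[/= d _] p]; rewrite (sr_DZ sr p) d linear0 subr0. Qed.

Lemma DdZ_M r s n h : aM r s n h -> Dd (Z h) = 0.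
Proof. by move=> [[/= _ d] p]; rewrite (sr_DdZ sr) d linear0 oppr0. Qed.

Lemma DZd_M r s n h : aM r s n h -> D (Zd h) = 0.
Proof. by move=> [[/= d _] p]; rewrite (sr_DZd sr) d linear0 oppr0. Qed.

Lemma DdZd_M r s n h : aM r s n h -> Dd (Zd h) = (s + m%:Z - n)%:~R *: h.
Proof. by move=> [[/= _ d] p]; rewrite (sr_DdZd sr p) d linear0 subr0. Qed.

(** With the common factor [a + n] taken out, [Z Zd] contributes [a + n + 1] and [Zd Z] contributes
    [b + m - n]. *)
Lemma D_aX a b n h : aM a b n h ->
  D (aX a b n h) = ((a + n) * (a + b + m%:Z + 1))%:~R *: Zd h.
Proof.
move=> Mh; have [[/= dh ddh] ph] := Mh; rewrite /aX linearB !linearZ /=.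
rewrite (sr_DZ sr (sr_Zd sr ph)) (DZd_M Mh) linear0 subr0.
rewrite (sr_DZd sr) opprK (DZ_M Mh) [Zd (_ *: _)]linearZ /= !scalerA -scalerDl.
by congr (_ *: _); rewrite -!intrM -intrD; congr (_%:~R); ring.
Qed.

Lemma Dd_aX a b n h : aM a b n h ->
  Dd (aX a b n h) = - (((b + m%:Z - n) * (a + b + m%:Z + 1))%:~R *: Z h).
Proof.
move=> Mh; have [[/= dh ddh] ph] := Mh; rewrite /aX linearB !linearZ /=.
rewrite (sr_DdZd sr (sr_Z sr ph)) (DdZ_M Mh) linear0 subr0.
rewrite (sr_DdZ sr) (DdZd_M Mh) [Z (_ *: _)]linearZ /= !scalerN !scalerA -opprD -scalerDl.
by congr (- (_ *: _)); rewrite -!intrM -intrD; congr (_%:~R); ring.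
Qed.

(** Up to sign, the eigenvalue of [D Dd aX] on monogenic elements of degree [(a, b, n)]. *)
Definition X_coef a b n : K :=
  ((a + n) * (b + m%:Z - n) * (a + b + m%:Z + 1))%:~R.

Lemma DDd_aX a b n h : aM a b n h -> D (Dd (aX a b n h)) = - (X_coef a b n *: h).
Proof.
move=> Mh; rewrite (Dd_aX Mh) linearN linearZ /= (DZ_M Mh) scalerA -intrM.
by congr (- (_%:~R *: _)); ring.
Qed.

(** The weights in [aX] make [D Dd] and [Dd D] send [aX a b n h] to opposite multiples of [h]. *)
Lemma aDelta_aX a b n h : aM a b n h -> aDelta (aX a b n h) = 0.
Proof.
move=> Mh; rewrite /aDelta (DDd_aX Mh) (D_aX Mh) [Dd (_ *: _)]linearZ /= (DdZd_M Mh).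
rewrite scalerA -intrM -scaleNr -scalerDl -intrN -intrD.
by rewrite [X in X%:~R](_ : _ = 0) ?scale0r //; ring.
Qed.

Lemma P_aX a b n h : P a b n h -> P (a + 1) (b + 1) n (aX a b n h).
Proof.
move=> ph; apply: P_sub; apply: (sr_PZ sr).
  by move: (sr_Z sr (sr_Zd sr ph)); rewrite addrK.
by move: (sr_Zd sr (sr_Z sr ph)); rewrite subrK.
Qed.

(** [1 <= n] makes [a + n] positive and [n <= m - 1] makes [b + m - n] positive. *)
Lemma X_coef_neq0 a b n :
  0 <= a -> 0 <= b -> 1 <= n <= m%:Z - 1 -> X_coef a b n != 0.
Proof.
move=> a0 b0 /andP[n1 n2]; rewrite intr_eq0 !mulf_neq0 //; lia.
Qed.

(** * The four-term decomposition of the harmonic space *)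

Lemma aRterm_harmonic r s n k : aRterm r s n k `<=` aH r s n.
Proof.
case: k => -[|[|[|[|//]]]] ? x; rewrite /aRterm /=.
- by case=> -[/= d dd] p; split=> //=; rewrite /aDelta dd d !linear0 addr0.
- case=> h Mh <-; have [[/= d dd] p] := Mh; split=> /=.
    by rewrite /aDelta (DdZ_M Mh) (DZ_M Mh) linear0 linearZ /= dd scaler0 addr0.
  by move: (sr_Z sr p); rewrite subrK addrK.
- case=> h Mh <-; have [[/= d dd] p] := Mh; split=> /=.
    by rewrite /aDelta (DZd_M Mh) (DdZd_M Mh) linear0 linearZ /= d scaler0 addr0.
  by move: (sr_Zd sr p); rewrite !subrK.
- rewrite /aXterm; case: ifP => _; last first.
    by move=> ->; split; [exact: linear0 | exact: (sr_P0 sr)].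
  case=> h Mh <-; split; first exact: aDelta_aX Mh.
  by case: Mh => _ /P_aX; rewrite !subrK.
Qed.

Lemma aXterm0 r s n : aXterm r s n 0.
Proof.
rewrite /aXterm; case: ifP => // _; exists 0; first exact: aM0.
by rewrite /aX !linear0 ?(subr0, addr0).
Qed.

(** Removes the obstruction to [D x] and [Dd x] being monogenic. The element [D (Dd x) = - Dd (D x)]
    is itself monogenic, and [aX] of a multiple of it serves as [y], unless it vanishes at a
    boundary degree. *)
Lemma aXterm_correction r s n x : aH r s n x ->
  exists2 y, aXterm r s n y & D (Dd y) = D (Dd x).
Proof.
move=> [/= hx px]; have anti : D (Dd x) = - Dd (D x).
  by apply/eqP; rewrite -addr_eq0; apply/eqP.
have Mg : aM (r - 1) (s - 1) n (D (Dd x)).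
  split; last by move: (sr_D sr (sr_Dd sr px)); rewrite subrK.
  by split; rewrite /= ?(sr_DD sr) // anti linearN (sr_DdDd sr) oppr0.
have zero : D (Dd x) = 0 -> exists2 y, aXterm r s n y & D (Dd y) = D (Dd x).
  by move=> ->; exists 0; [exact: aXterm0 | rewrite !linear0].
have [rs|rs] := boolP ((0 <= r - 1) && (0 <= s - 1)); last first.
  apply/zero/(aM_out _ Mg); lia.
have [hn|hn] := boolP (1 <= n <= m%:Z - 1); last first.
  (* Either [n >= m] and [D x] has spin degree above [m], or [n <= 0] and [Dd x] has negative spin
     degree. *)
  apply: zero; have [n0|n0] := lerP 1 n.
    by rewrite anti ((sr_out sr) _ _ _ _ _ (sr_D sr px)) ?linear0 ?oppr0 //; lia.
  by rewrite ((sr_out sr) _ _ _ _ _ (sr_Dd sr px)) ?linear0 //; lia.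
case/andP: rs => r1 s1; have c0 := X_coef_neq0 r1 s1 hn.
have Mh := aMZ (- (X_coef (r - 1) (s - 1) n)^-1) Mg.
exists (aX (r - 1) (s - 1) n (- (X_coef (r - 1) (s - 1) n)^-1 *: D (Dd x))).
  by rewrite /aXterm hn; exists (- (X_coef (r - 1) (s - 1) n)^-1 *: D (Dd x)).
by rewrite (DDd_aX Mh) scalerA mulrN divff // scaleN1r opprK.
Qed.

Lemma sum4 (y : 'I_4 -> V) : \sum_i y i =
  y ord0 + y (lift ord0 ord0) + y (lift ord0 (lift ord0 ord0)) + y ord_max.
Proof.
rewrite !big_ord_recl big_ord0 addr0 !addrA; congr (_ + y _); exact/val_inj.
Qed.

Lemma harmonic_direct_sum r s n : 0 <= r -> 0 <= s -> 0 <= n <= m%:Z ->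
  is_direct_sum (aH r s n) (aRterm r s n).
Proof.
(* The scalar [r + n] vanishes only for [r = 0], where degree [r - 1] leaves no nonzero [u].
   Likewise [s + m - n = 0] forces [s = 0] in [out_s]. *)
move=> r0 s0 n0; have out_r u : aM (r - 1) s (n + 1) u -> (r + n)%:~R *: u = 0 ->
    u = 0.
  have [rn|rn] := eqVneq (r + n) 0.
    by move=> /aM_out Mu _; apply: Mu; lia.
  by move=> _ /eqP; rewrite scaler_eq0 intr_eq0 (negbTE rn) => /eqP.
have out_s v : aM r (s - 1) (n - 1) v -> (s + m%:Z - n)%:~R *: v = 0 -> v = 0.
  have [sn|sn] := eqVneq (s + m%:Z - n) 0.
    by move=> /aM_out Mv _; apply: Mv; lia.
  by move=> _ /eqP; rewrite scaler_eq0 intr_eq0 (negbTE sn) => /eqP.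
have er : r - 1 + (n + 1) = r + n by ring.
have es : s - 1 + m%:Z - (n - 1) = s + m%:Z - n by ring.
split.
  apply/seteqP; split=> [x hx|x [y [yR ->]]]; last first.
    split=> /=.
      rewrite -[LHS]/(aDelta _) linear_sum big1 // => i _.
      by case: (aRterm_harmonic (yR i)).
    by apply: P_sum => i; case: (aRterm_harmonic (yR i)).
  (* The [aX] part is split off first; for the remainder [w], both [D w] and [Dd w] are
     monogenic. *)
  have [y yX Dy] := aXterm_correction hx.
  have [/= xh xP] : aH r s n (x - y).
    have [yh yP] := aRterm_harmonic (yX : aRterm r s n ord_max y).
    have [/= xh xP] := hx; split; last exact: P_sub.
    by rewrite /= -[LHS]/(aDelta _) linearB /= xh yh subr0.
  have DDd0 : D (Dd (x - y)) = 0 by rewrite !linearB /= Dy subrr.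
  move: xh xP DDd0; have : x = x - y + y by rewrite subrK.
  move: (x - y) => w xw xh xP DDd0.
  have DdD0 : Dd (D w) = 0 by move: xh; rewrite /aDelta DDd0 add0r.
  have Mu : aM (r - 1) s (n + 1) (D w).
    by split; [split; [exact: (sr_DD sr) | ] | exact: (sr_D sr)].
  have Mv : aM r (s - 1) (n - 1) (Dd w).
    by split; [split; [ | exact: (sr_DdDd sr)] | exact: (sr_Dd sr)].
  set u := D w in Mu; set v := Dd w in Mv.
  (* The inverse of 0 is 0; when a scalar vanishes, [out_r] or [out_s] gives [u = 0] or [v = 0], so
     [DZu] and [DdZdv] still hold. *)
  set u' := (r + n)%:~R^-1 *: u; set v' := (s + m%:Z - n)%:~R^-1 *: v.
  have Mu' : aM (r - 1) s (n + 1) u' by exact: aMZ.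
  have Mv' : aM r (s - 1) (n - 1) v' by exact: aMZ.
  have DZu : D (Z u') = u.
    rewrite (DZ_M Mu') er /u' scalerA; have [rn|rn] := eqVneq ((r + n)%:~R : K) 0.
      by rewrite rn mul0r scale0r (out_r u) // rn scale0r.
    by rewrite divff // scale1r.
  have DdZdv : Dd (Zd v') = v.
    rewrite (DdZd_M Mv') es /v' scalerA.
    have [sn|sn] := eqVneq ((s + m%:Z - n)%:~R : K) 0.
      by rewrite sn mul0r scale0r (out_s v) // sn scale0r.
    by rewrite divff // scale1r.
  exists (tnth [tuple w - Z u' - Zd v'; Z u'; Zd v'; y]); split; last first.
    by rewrite sum4 !(tnth_nth 0) /= [w - _ - _ + _]addrAC !subrK.
  case=> -[|[|[|[|//]]]] ?; rewrite (tnth_nth 0) /=.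
  - split; first split; rewrite /= ?linearB ?linearB /=.
    + by rewrite -/u DZu subrr (DZd_M Mv') subr0.
    + by rewrite -/v (DdZ_M Mu') subr0 DdZdv subrr.
    + apply: P_sub; first apply: P_sub => //.
        by case: Mu' => _ /(sr_Z sr); rewrite subrK addrK.
      by case: Mv' => _ /(sr_Zd sr); rewrite !subrK.
  - by exists u'.
  - by exists v'.
  - exact: yX.
move=> y yR; rewrite sum4 => y0.
have [[/= d0 dd0] _] := yR ord0.
have [u Mu yu] := yR (lift ord0 ord0).
have [v Mv yv] := yR (lift ord0 (lift ord0 ord0)).
have yX : aXterm r s n (y ord_max) := yR ord_max.
have y3 : y ord_max = 0.
  (* [D Dd] kills the first three summands and so isolates the [aX] term. *)
  have : D (Dd (y ord_max)) = 0.
    have: D (Dd (y ord0 + Z u + Zd v + y ord_max)) = 0 by rewrite yu yv y0 !linear0.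
    rewrite !linearD /= dd0 (DdZ_M Mu) linear0 !add0r (DdZd_M Mv) linearZ /=.
    by case: Mv => -[/= -> _] _; rewrite scaler0 add0r.
  move: yX; rewrite /aXterm; case: ifP => [hn [h Mh <-]|_ //].
  rewrite (DDd_aX Mh) => /eqP; rewrite oppr_eq0 scaler_eq0.
  have [rs|rs] := boolP ((0 <= r - 1) && (0 <= s - 1)).
    case/andP: rs => r1 s1; rewrite (negbTE (X_coef_neq0 r1 s1 hn)) => /eqP ->.
    by rewrite /aX !linear0 ?(subr0, addr0).
  (* A negative polynomial degree forces [h = 0], whatever the value of [X_coef]. *)
  rewrite (aM_out _ Mh); last lia.
  by rewrite /aX !linear0 ?(subr0, addr0).
rewrite y3 addr0 in y0.
(* Of the three remaining summands, [D] sees only [Z u] and [Dd] only [Zd v]. *)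
have u0 : u = 0.
  apply: (out_r _ Mu).
  have: D (y ord0 + Z u + Zd v) = 0 by rewrite yu yv y0 linear0.
  by rewrite !linearD /= d0 (DZ_M Mu) (DZd_M Mv) add0r addr0 er.
have v0 : v = 0.
  apply: (out_s _ Mv).
  have: Dd (y ord0 + Z u + Zd v) = 0 by rewrite yu yv y0 linear0.
  by rewrite !linearD /= dd0 (DdZ_M Mu) (DdZd_M Mv) !add0r es.
move: y0; rewrite -yu -yv u0 v0 !linear0 !addr0 => y0 i.
have y1 : y (lift ord0 ord0) = 0 by rewrite -yu u0 linear0.
have y2 : y (lift ord0 (lift ord0 ord0)) = 0 by rewrite -yv v0 linear0.
case: i => -[|[|[|[|//]]]] hi.
- by rewrite -y0; congr y; apply: val_inj.
- by rewrite -y1; congr y; apply: val_inj.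
- by rewrite -y2; congr y; apply: val_inj.
- by rewrite -y3; congr y; apply: val_inj.
Qed.

(** * Powers of rho and the Fischer decomposition *)

Lemma P_arho r s n x : P r s n x -> P (r + 1) (s + 1) n (arho x).
Proof.
move=> px; apply: (sr_PD sr).
  by move: (sr_Z sr (sr_Zd sr px)); rewrite addrK.
by move: (sr_Zd sr (sr_Z sr px)); rewrite subrK.
Qed.

Lemma P_iter_arho r s n j x :
  P r s n x -> P (r + j%:Z) (s + j%:Z) n (iter j arho x).
Proof.
move=> px; elim: j => [|j /P_arho IH]; first by rewrite !addr0.
by move: IH; rewrite -!addrA -!PoszD !addn1.
Qed.

(** The scalars of the anticommutator of [D] and [Z] at [Zd x] and at [x] differ by one, which
    leaves a single [Zd x]. *)
Lemma D_arho r s n x : P r s n x -> D (arho x) = arho (D x) + Zd x.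
Proof.
move=> px; rewrite /arho linearD /= (sr_DZ sr (sr_Zd sr px)) (sr_DZd sr).
rewrite (sr_DZd sr) (sr_DZ sr px) linearN opprK linearB /= [Zd (_ *: _)]linearZ /=.
have -> : (r + (n + 1))%:~R = (r + n)%:~R + 1 :> K by ring.
rewrite scalerDl scale1r opprB.
by rewrite [LHS](AC (3*2) (3*4*2*(1*5))) /= subrr addr0.
Qed.

Lemma Dd_arho r s n x : P r s n x -> Dd (arho x) = arho (Dd x) + Z x.
Proof.
move=> px; rewrite /arho linearD /= (sr_DdZd sr (sr_Z sr px)) (sr_DdZ sr).
rewrite (sr_DdZ sr) (sr_DdZd sr px) linearN opprK linearB /= [Z (_ *: _)]linearZ /=.
have -> : (s + m%:Z - (n - 1))%:~R = (s + m%:Z - n)%:~R + 1 :> K.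
  by ring.
rewrite scalerDl scale1r opprB.
by rewrite [LHS](AC (2*3) (1*5*4*(3*2))) /= subrr addr0.
Qed.

(** Moving [arho] out of [D] and [Dd] leaves the anticommutators of [D, Z] and of [Dd, Zd], with
    scalars [r + n] and [s + m - n]. *)
Lemma aDelta_arho r s n x : P r s n x ->
  aDelta (arho x) = arho (aDelta x) + (r + s + m%:Z)%:~R *: x.
Proof.
move=> px; rewrite /aDelta (Dd_arho px) (D_arho px).
rewrite [D (_ + Z x)]linearD [Dd (_ + Zd x)]linearD [arho (_ + _)]linearD /=.
rewrite (D_arho (sr_Dd sr px)) (Dd_arho (sr_D sr px)) (sr_DZ sr px) (sr_DdZd sr px).
have -> : r + s + m%:Z = r + n + (s + m%:Z - n) by ring.
rewrite [in RHS]intrD scalerDl.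
by rewrite [LHS](AC ((2*2)*(2*2)) (1*5*(3*7)*(2*8)*(6*4))) /= !subrr !addr0.
Qed.

(** Each power raises both degrees by one, so the scalar is the sum of [r + s + m + 2i] over
    [i <= j]. *)
Lemma aDelta_iter_arho r s n j h : aH r s n h ->
  aDelta (iter j.+1 arho h) =
  (j.+1%:Z * (r + s + m%:Z + j%:Z))%:~R *: iter j arho h.
Proof.
move=> [/= hh ph]; have {}hh : aDelta h = 0 by [].
elim: j => [|j IH]; first by rewrite /= (aDelta_arho ph) hh linear0 add0r mul1r addr0.
rewrite [in LHS]iterS (aDelta_arho (P_iter_arho j.+1 ph)) IH.
rewrite [arho (_ *: _)]linearZ /= -scalerDl -intrD.
by congr (_%:~R *: _); rewrite !(intS j.+1, intS j); ring.
Qed.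

Context (m_gt0 : (0 < m)%N).

(** The terms [r - j], [s - j] and [j] are nonnegative and [m] is positive. *)
Lemma iter_arho_coef_neq0 (r s : nat) j : (j <= r)%N -> (j <= s)%N ->
  (j.+1%:Z * (r%:Z - j%:Z + (s%:Z - j%:Z) + m%:Z + j%:Z))%:~R != 0 :> K.
Proof. by move=> jr js; rewrite intr_eq0 mulf_neq0 //; lia. Qed.

(** The [j]-th Fischer summand, with the harmonic space in place of its four-term form. *)
Definition layer r s n k (j : 'I_k) : set V :=
  iter j arho @` aH (r - j%:Z) (s - j%:Z) n.

Lemma sum_layers r s n k x : sumset (@layer r s n k) x -> P r s n x.
Proof.
move=> [y [yL ->]]; apply: P_sum => j; case: (yL j) => h [_ ph] <-.
by move: (P_iter_arho j ph); rewrite !subrK.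
Qed.

Lemma iter_arhoZ j c x : iter j arho (c *: x) = c *: iter j arho x.
Proof. by elim: j => //= j ->; rewrite linearZ. Qed.

Lemma layer_lift (r s : nat) n k (j : 'I_k) c h :
  aH (r%:Z - j%:Z) (s%:Z - j%:Z) n h ->
  layer r.+1 s.+1 n (lift ord0 j) (arho (c *: iter j arho h)).
Proof.
move=> [/= hh ph]; have e (t : nat) : t.+1%:Z - (lift ord0 j : nat)%:Z = t%:Z - j%:Z.
  by rewrite lift0; lia.
exists (c *: h).
  rewrite !e; split; last exact: (sr_PZ sr).
  by rewrite /= -[LHS]/(aDelta _) linearZ /= hh scaler0.
by rewrite lift0 iterS iter_arhoZ.
Qed.

(** By induction, [aDelta x] is a sum of layers [y j]. Each has a preimage [z j] under [aDelta], a
    multiple of [arho (y j)], so [x] minus the sum of the [z j] is harmonic. *)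
Lemma layers_span k (r s : nat) n x : minn r s = k -> P r s n x ->
  sumset (@layer r s n k.+1) x.
Proof.
elim: k r s x => [|k IH] r s x rs px.
  exists (fun _ => x); split; last by rewrite big_ord1.
  move=> j; rewrite ord1; exists x => //; rewrite /= !subr0; split=> //=.
  (* As [r] or [s] is 0, [aDelta x] has a negative degree; hence every [x] is harmonic. *)
  apply: (sr_out sr (r := r%:Z - 1) (s := s%:Z - 1) (n := n)); first lia.
  apply: (sr_PD sr); first by move: (sr_D sr (sr_Dd sr px)); rewrite subrK.
  by move: (sr_Dd sr (sr_D sr px)); rewrite addrK.
case: r s rs px => [|r] [|s] //; rewrite minnSS => -[rs] px.
have [|y [yL ey]] := IH r s (aDelta x) rs.
  have -> : r%:Z = r.+1%:Z - 1 by lia.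
  have -> : s%:Z = s.+1%:Z - 1 by lia.
  apply: (sr_PD sr); first by move: (sr_D sr (sr_Dd sr px)); rewrite subrK.
  by move: (sr_Dd sr (sr_D sr px)); rewrite addrK.
(* The scalar of [aDelta_iter_arho] for a harmonic element of degree [(r - j, s - j)]. *)
pose c (j : nat) : K := (j.+1%:Z * (r%:Z - j%:Z + (s%:Z - j%:Z) + m%:Z + j%:Z))%:~R.
have c0 (j : 'I_k.+1) : c j != 0.
  by apply: iter_arho_coef_neq0; have := ltn_ord j; lia.
pose z (j : 'I_k.+1) := arho ((c j)^-1 *: y j).
have zL j : layer r.+1 s.+1 n (lift ord0 j) (z j).
  by case: (yL j) => h Hh e; rewrite /z -e; apply: layer_lift.
have Dz j : aDelta (z j) = y j.
  case: (yL j) => h Hh e; rewrite /z -e linearZ /= linearZ /= -iterS.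
  by rewrite (aDelta_iter_arho _ Hh) scalerA mulVf ?scale1r //; apply: c0.
(* Layer 0 receives the harmonic remainder, layer [i + 1] receives [z i]. *)
exists (fun j => if unlift ord0 j is Some i then z i else x - \sum_i z i).
split=> [j|]; last first.
  rewrite big_ord_recl unlift_none [X in _ + X](eq_bigr z) ?subrK // => i _.
  by rewrite liftK.
case: unliftP => [i ->|->]; first exact: zL.
have zP : P r.+1 s.+1 n (\sum_i z i).
  apply: P_sum => i; case: (zL i) => h [_ ph] <-.
  by move: (P_iter_arho (lift ord0 i) ph); rewrite !subrK.
exists (x - \sum_i z i) => //; rewrite !subr0; split; last exact: P_sub.
rewrite /= -[LHS]/(aDelta _) linearB /= ey linear_sum; apply/eqP; rewrite subr_eq0.
by apply/eqP/eq_bigr => i _; rewrite /= Dz.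
Qed.

(** [aDelta] kills layer 0 and lowers each other layer by one with a nonzero scalar, so a relation
    between layers descends to smaller degrees. *)
Lemma layers_independent k (r s : nat) n : minn r s = k ->
  independent (@layer r s n k.+1).
Proof.
elim: k r s => [|k IH] r s rs y yL; first by rewrite big_ord1 => y0 i; rewrite ord1.
case: r s rs yL => [|r] [|s] //; rewrite minnSS => -[rs] yL.
pose c (j : nat) : K := (j.+1%:Z * (r%:Z - j%:Z + (s%:Z - j%:Z) + m%:Z + j%:Z))%:~R.
have c0 (j : 'I_k.+1) : c j != 0.
  by apply: iter_arho_coef_neq0; have := ltn_ord j; lia.
have yE (j : 'I_k.+1) : exists2 h, aH (r%:Z - j%:Z) (s%:Z - j%:Z) n h &
    y (lift ord0 j) = arho (iter j arho h).
  case: (yL (lift ord0 j)) => h; rewrite lift0 => Hh <-; exists h => //.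
  by move: Hh; congr (aH _ _ n h); lia.
have y0 : aDelta (y ord0) = 0 by case: (yL ord0) => h [/= hh _] <-.
rewrite big_ord_recl => ysum.
have Dy j : aDelta (y (lift ord0 j)) = 0.
  move: j; apply: (IH r s rs (fun j => aDelta (y (lift ord0 j)))).
    move=> j; case: (yE j) => h [/= hh ph] ->; exists (c j *: h).
      split; last exact: (sr_PZ sr).
      by rewrite /= -[LHS]/(aDelta _) linearZ /= hh scaler0.
    rewrite -iterS (@aDelta_iter_arho (r%:Z - j%:Z) (s%:Z - j%:Z) n) //.
    exact: iter_arhoZ.
  have : aDelta (y ord0 + \sum_(i < k.+1) y (lift ord0 i)) = 0.
    by rewrite ysum linear0.
  by rewrite linearD /= y0 add0r linear_sum.
have yl j : y (lift ord0 j) = 0.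
  (* The nonzero scalar gives [iter j arho h = 0], and one more [arho] gives
     [y (lift ord0 j) = 0]. *)
  case: (yE j) (Dy j) => h Hh ->; rewrite -iterS (aDelta_iter_arho _ Hh).
  move/eqP; rewrite scaler_eq0 -/(c j) (negbTE (c0 j)) => /eqP /= ->.
  exact: linear0.
move: ysum; rewrite big1 ?addr0 => [y00 i|i _]; last exact: yl.
by case: (unliftP ord0 i) => [j ->|->]; rewrite ?yl.
Qed.

Lemma fischer_direct_sum (r s : nat) n : 0 <= n <= m%:Z ->
  is_direct_sum (P r s n) (fun j : 'I_(minn r s).+1 =>
    iter j arho @` sumset (aRterm (r%:Z - j%:Z) (s%:Z - j%:Z) n)).
Proof.
move=> n0; have -> : (fun j : 'I_(minn r s).+1 =>
    iter j arho @` sumset (aRterm (r%:Z - j%:Z) (s%:Z - j%:Z) n)) =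
    @layer r s n (minn r s).+1.
  (* Since [j <= minn r s], both degrees stay nonnegative and the harmonic decomposition rewrites
     each layer. *)
  apply: boolp.funext => j; have := ltn_ord j; rewrite ltnS leq_min => /andP[jr js].
  have /harmonic_direct_sum H : 0 <= r%:Z - j%:Z by lia.
  have {H} /H : 0 <= s%:Z - j%:Z by lia.
  by move=> /(_ _ n0)[<- _].
split; last exact: layers_independent.
apply/seteqP; split=> x; last exact: sum_layers.
exact: layers_span.
Qed.
End AbstractDecomposition.

(** * Application to polynomial spinors *)

Section Instantiation.
Context {K : numFieldType} {m : nat} (q : K) (hq : 0 < q < 1).

Lemma hat_spin_relations : @spin_relations K (PP K m) m
  (@calD K m q) (@calDd K m q) (@hatZ K m q) (@hatZd K m q) (@Prsn K m).
Proof.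
split.
- exact: Prsn0.
- exact: PrsnD.
- exact: PrsnZ.
- by move=> r s n x /Prsn_eq0 ->.
- exact: Prsn_calD.
- exact: Prsn_calDd.
- exact: Prsn_hatZ.
- exact: Prsn_hatZd.
- exact: calD_sq.
- exact: calDd_sq.
- exact: calD_hatZd.
- exact: calDd_hatZ.
- exact: calD_hatZ.
- exact: calDd_hatZd.
Qed.

Lemma arho_hatrho : arho (@hatZ K m q) (@hatZd K m q) = hatrho q.
Proof. by apply: boolp.funext => F; apply: hatZ_hatZd. Qed.

Lemma aDelta_Delta : aDelta (@calD K m q) (@calDd K m q) = Delta q.
Proof. by apply: boolp.funext => F; apply: calD_calDd. Qed.

Lemma Hrsn_direct_sum (r s n : nat) : (n <= m)%N ->
  is_direct_sum (@Hrsn K m q r s n) (Rterm q r s n).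
Proof.
move=> nm; have := @harmonic_direct_sum _ _ _ _ _ _ _ _ hat_spin_relations r s n.
by rewrite /aH aDelta_Delta; apply.
Qed.

Lemma Prsn_direct_sum (r s n : nat) : (0 < m)%N -> (n <= m)%N ->
  is_direct_sum (@Prsn K m r s n)
    (fun j : 'I_(minn r s).+1 =>
       iter j (hatrho q) @` Rrsn q (r%:Z - j%:Z) (s%:Z - j%:Z) n).
Proof.
move=> m0 nm; have := @fischer_direct_sum _ _ _ _ _ _ _ _ hat_spin_relations m0 r s n.
by rewrite arho_hatrho; apply.
Qed.
End Instantiation.

Theorem theorem5p5 (R : realType) (m : nat) (q : R)
    (hm : (1 <= m)%N) (hq0 : 0 < q) (hq1 : q < 1) (r s n : nat)
    (hn : (n <= m)%N) :
  is_direct_sum (@Hrsn R[i] m (q%:C)%C r s n) (Rterm (q%:C)%C r s n) /\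
  is_direct_sum (@Prsn R[i] m r s n)
    (fun j : 'I_(minn r s).+1 =>
       iter j (hatrho (q%:C)%C) @`
         Rrsn (q%:C)%C (r%:Z - j%:Z) (s%:Z - j%:Z) n).
Proof.
(* The order of [R[i]] restricts to that of [R] on real elements, so the bounds on [q] carry
   over. *)
have hq : (0 : R[i]) < (q%:C)%C < 1 by rewrite !ltcR hq0 hq1.
by split; [apply: Hrsn_direct_sum | apply: Prsn_direct_sum].
Qed.
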